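(* There is an absolute constant $c>0$ such that the following holds. Let $k\ge1$, $n=2^k$, let $\mathbb{F}$ be any field, and let $d,\Delta$ be integers with $d\le n$ sufficiently large (larger than some absolute constant) and $1\le \Delta\le \log d/\log\log d$. Then any set-multilinear formula over $\mathbb{F}$, set-multilinear with respect to $(X_1,\dots,X_d)$, of product-depth $\Delta$ computing $NW_{n,d}$ has size at least $d^{c\, d^{1/\Delta}/\Delta}$.
   Context: Let $\mathbb{F}_n$ be the finite field with $n$ elements, and fix a bijection $\phi:[n]\to\mathbb{F}_n$; through it we identify $[n]$ with $\mathbb{F}_n$. For $f\in\mathbb{F}_n[z]$ and $j\in[d]$, $f(j)$ means $\phi^{-1}(f(\phi(j)))\in[n]$. Variables are $x_{i,j}$, $i\in[n]$, $j\in[d]$, partitioned as $X_j=\{x_{i,j}: i\in[n]\}$, $j\in[d]$. The Nisan–Wigderson polynomial (coefficients in $\mathbb{F}$) is $NW_{n,d}=\sum_{f\in\mathbb{F}_n[z],\ \deg f<d/2}\prod_{j\in[d]}x_{f(j),j}$. An algebraic formula is a rooted tree whose internal nodes are labeled $+$ or $\times$ and whose leaves are labeled by variables or field constants; its size is its number of nodes and its product-depth is the maximum number of $\times$ nodes on a root-to-leaf path. A polynomial is set-multilinear with respect to a tuple of disjoint variable sets $(X_j)_{j\in S}$ if every monomial contains exactly one variable from each $X_j$, $j\in S$, and no other variables; a formula is set-multilinear with respect to $(X_1,\dots,X_d)$ if every node computes a polynomial that is set-multilinear with respect to $(X_j)_{j\in S}$ for some $S\subseteq[d]$. Logarithms are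 base 2. *)

(* Defs.v *)
From HB Require Import structures.
From mathcomp Require Import all_boot all_order all_algebra.
From mathcomp Require Import qpoly mpoly.
From mathcomp Require Import reals exp.

Set Implicit Arguments.
Unset Strict Implicit.
Unset Printing Implicit Defensive.

Import GRing.Theory Num.Theory.
Local Open Scope ring_scope.

Definition log2 (R : realType) (x : R) : R := ln x / ln 2.

(* The variables x_{i,j} are flattened to the n * d indeterminates of          *)
(* {mpoly F[n * d]} by the bijection mxvec_index; indices are 0-based.         *)
Definition xvar (F : fieldType) (n d : nat) (i : 'I_n) (j : 'I_d) :
    {mpoly F[n * d]} :=
  'X_(mxvec_index i j).

(* The bijection between [n] and K is given together with its inverse phi'.    *)
(* [d] is seen inside [n] through widen_ord. A polynomial of degree < d / 2    *)
(* has size <= d, so the finite type {poly_d K} contains all of them; since    *)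
(* deg f = (size f).-1, the filter is deg f < d / 2 (for d > 0, it keeps 0).   *)
Definition NW (F : fieldType) (K : finFieldType) (n d : nat)
    (phi : 'I_n -> K) (phi' : K -> 'I_n) (led : (d <= n)%N) :
    {mpoly F[n * d]} :=
  \sum_(f : {poly_d K} | ((size f).-1.*2 < d)%N)
    \prod_(j < d) xvar F (phi' (val f).[phi (widen_ord led j)]) j.

(* Internal nodes have arbitrary positive fan-in k.+1. *)
Inductive formula (F : fieldType) (n d : nat) : Type :=
| FVar of 'I_n & 'I_d
| FConst of F
| FSum (k : nat) of ('I_k.+1 -> formula F n d)
| FProd (k : nat) of ('I_k.+1 -> formula F n d).

Section Formula.
Variables (F : fieldType) (n d : nat).
Implicit Type t : formula F n d.

Fixpoint feval t : {mpoly F[n * d]} :=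
  match t with
  | FVar i j => xvar F i j
  | FConst a => a%:MP
  | FSum k g => \sum_(i < k.+1) feval (g i)
  | FProd k g => \prod_(i < k.+1) feval (g i)
  end.

Fixpoint fsize t : nat :=
  match t with
  | FVar _ _ | FConst _ => 1
  | FSum k g | FProd k g => (\sum_(i < k.+1) fsize (g i)).+1
  end%N.

Fixpoint product_depth t : nat :=
  match t with
  | FVar _ _ | FConst _ => 0
  | FSum k g => \max_(i < k.+1) product_depth (g i)
  | FProd k g => (\max_(i < k.+1) product_depth (g i)).+1
  end%N.

(* In every monomial of p, the total degree in the variables of X_j is 1 if    *)
(* j \in S and 0 otherwise.                                                    *)
Definition set_multilinear (S : {set 'I_d}) (p : {mpoly F[n * d]}) : Prop :=
  forall m : 'X_{1..n * d}, m \in msupp p ->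
    forall j : 'I_d, (\sum_(i < n) m (mxvec_index i j))%N = (j \in S).

Fixpoint set_multilinear_formula t : Prop :=
  (exists S : {set 'I_d}, set_multilinear S (feval t)) /\
  match t with
  | FVar _ _ | FConst _ => True
  | FSum k g | FProd k g => forall i, set_multilinear_formula (g i)
  end.

End Formula.

(* Main.v *)
Require Import Defs.
From HB Require Import structures.
From mathcomp Require Import all_boot all_order all_algebra.
From mathcomp Require Import qpoly mpoly.
From mathcomp Require Import reals exp.
From mathcomp Require Import interval_inference sequences convex.
From mathcomp Require Import ring lra zify.

Set Implicit Arguments.
Unset Strict Implicit.
Unset Printing Implicit Defensive.

Import Order.TTheory GRing.Theory Num.Theory.
Local Open Scope ring_scope.

(* For a subset W of the block indices, evaluate a polynomial at the 0/1       *)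
(* points selecting one variable per block; splitting the selection into its   *)
(* part on W and its part off W gives a matrix M_W whose rank is subadditive   *)
(* and, as M_W sends products to Hadamard products, submultiplicative.         *)
(* With v = n^(-1/2), a polynomial that is set-multilinear on S has            *)
(* rank M_W * v^|S| at most v^||S & W| - |S \ W||. Averaging over W, disjoint  *)
(* factors on sets of b_i blocks contribute independent means, each at most    *)
(* (1 + b_i)^(-1/4). With q = d^(1/Delta), a formula of product-depth delta on *)
(* at least q^delta blocks either has a factor on q^(delta-1) blocks, handled  *)
(* by induction, or all b_i are smaller and concavity of ln bounds the product *)
(* by (1 + q)^(-q/4). Conversely, by interpolation, M_W of NW has full rank    *)
(* whenever W is balanced, which has probability at least 1 / (d + 1). When d  *)
(* is odd, one block is first frozen to a single variable (J is the set of the *)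
(* remaining ones), so that balanced W exist.                                  *)

(** The complexity measure is [nrank], the rank of M_W rescaled by [v ^ |S|], where [S] is the
    support inside [J]; it is at most 1 for set-multilinear polynomials. It is subadditive at sum
    nodes, because the summands whose support differs from that of the sum cancel out
    ([support_set_sum]), and submultiplicative at product nodes, because the supports of the factors
    partition that of a nonzero product ([card_support_set_prod], [support_set_prod_disjoint]). A
    fixed W might split every factor evenly, in which case nothing is lost; a random W seldom splits
    a large factor evenly, and the factors behave independently. Hence the mean of [nrank] over W is
    at most the size times [(1 + q) ^ (- q / 4)] ([formula_mean_nrank]).

    In the other direction, polynomials of degree below d / 2 are determined by their values on half
    of the points, so for balanced W the matrix of NW contains an identity matrix of the largest
    possible rank ([NW_split_rank_ge]). Comparing the two means gives size at least
    [(1 + q) ^ (q / 4) / (d + 1)] ([formula_size_decay]), and the bound on Delta makes q large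
    enough to absorb the factor d + 1 ([root_decay]). *)

Lemma mxrank_hadamard (F : fieldType) (m n : nat) (A B : 'M[F]_(m, n)) :
  (\rank (map2_mx *%R A B) <= \rank A * \rank B)%N.
Proof.
(* Rank factorizations of [A] and [B] combine into one of the Hadamard product whose inner index
   runs over pairs. *)
pose I : finType := ('I_(\rank A) * 'I_(\rank B))%type.
pose U := \matrix_(i < m, x < #|I|)
  (col_base A i (enum_val x).1 * col_base B i (enum_val x).2).
pose V := \matrix_(x < #|I|, j < n)
  (row_base A (enum_val x).1 j * row_base B (enum_val x).2 j).
have -> : map2_mx *%R A B = U *m V.
  apply/matrixP=> i j; rewrite !mxE -{1}(mulmx_base A) -{1}(mulmx_base B) !mxE.
  rewrite mulr_suml (eq_bigr (fun k => \sum_l (col_base A i k * col_base B i l) *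
    (row_base A k j * row_base B l j))); last first.
    by move=> k _; rewrite mulr_sumr; apply: eq_bigr => l _; rewrite mulrACA.
  rewrite pair_bigA (reindex _ (onW_bij _ (@enum_val_bij I))) /=.
  by apply: eq_bigr => x _; rewrite !mxE.
apply: leq_trans (mxrankM_maxl _ _) _; apply: leq_trans (rank_leq_col _) _.
by rewrite card_prod !card_ord.
Qed.

Lemma mxrank_sum_le (F : fieldType) (m n : nat) (I : finType) (P : pred I)
    (A : I -> 'M[F]_(m, n)) :
  (\rank (\sum_(i | P i) A i)%R <= \sum_(i | P i) \rank (A i))%N.
Proof.
elim/big_rec2: _ => [|i r M _ le_r]; first by rewrite mxrank0.
by apply: leq_trans (mxrank_add _ _) _; rewrite leq_add2l.
Qed.

Lemma mxrank_le_card_rows (F : fieldType) (m n : nat) (A : 'M[F]_(m, n))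
    (C : {set 'I_m}) :
  (forall i, exists2 i', i' \in C & row i A = row i' A) -> (\rank A <= #|C|)%N.
Proof.
move=> rowA; have sA : (A <= \sum_(i in C) <<row i A>>)%MS.
  by apply/row_subP=> i; have [i' iC ->] := rowA i; apply: (sumsmx_sup i'); rewrite ?genmxE.
apply: leq_trans (mxrankS sA) _.
rewrite -sum1_card; elim/big_rec2: _ => [|i r B _ le_r]; first by rewrite mxrank0.
apply: leq_trans (leq_of_leqif (mxrank_adds_leqif _ _)) _.
by rewrite mxrank_gen leq_add // rank_leq_row.
Qed.

(** * The evaluation matrix of a split of the blocks *)

Definition indicator_point (F : fieldType) (n d : nat) (c : {ffun 'I_d -> 'I_n}) :
    'I_(n * d) -> F :=
  mxvec (\matrix_(i < n, j < d) (i == c j)%:R) 0.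
Arguments indicator_point F {n d} c _.

Definition mix (n d : nat) (i0 : 'I_n) (J W : {set 'I_d})
    (a b : {ffun 'I_d -> 'I_n}) : {ffun 'I_d -> 'I_n} :=
  [ffun j => if j \in J then if j \in W then a j else b j else i0].

(** Both sides range over full selections although only the blocks of [J :&: W], resp. [J :\: W],
    matter: repeated rows and columns leave the rank unchanged, and the format is the same for all
    [W]. *)
Definition split_mx (F : fieldType) (n d : nat) (i0 : 'I_n) (J W : {set 'I_d})
    (p : {mpoly F[n * d]}) : 'M[F]_#|{ffun 'I_d -> 'I_n}| :=
  \matrix_(x, y) p.@[indicator_point F (mix i0 J W (enum_val x) (enum_val y))].

Section SplitRank.
Variables (F : fieldType) (n d : nat) (i0 : 'I_n) (J : {set 'I_d}).
Implicit Types (p q : {mpoly F[n * d]}) (W S : {set 'I_d}).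

Notation M := (split_mx i0 J).

Lemma split_mx_sum W (I : finType) (P : pred I) (p : I -> {mpoly F[n * d]}) :
  M W (\sum_(i | P i) p i) = \sum_(i | P i) M W (p i).
Proof.
apply/matrixP=> x y; rewrite summxE !mxE rmorph_sum /=.
by apply: eq_bigr => i _; rewrite mxE.
Qed.

Lemma split_rankM W p q :
  (\rank (M W (p * q)) <= \rank (M W p) * \rank (M W q))%N.
Proof.
have -> : M W (p * q) = map2_mx *%R (M W p) (M W q).
  by apply/matrixP=> x y; rewrite !mxE rmorphM.
exact: mxrank_hadamard.
Qed.

Lemma split_rank1 W : (\rank (M W (1 : {mpoly F[n * d]})) <= 1)%N.
Proof.
apply: (@leq_trans (\rank (const_mx 1 : 'M[F]_(#|{ffun 'I_d -> 'I_n}|, 1))));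
  last exact: rank_leq_col.
have -> : M W (1 : {mpoly F[n * d]}) = const_mx 1 *m (const_mx 1 : 'M[F]_(1, _)).
  by apply/matrixP=> x y; rewrite !mxE big_ord1 !mxE mulr1 rmorph1.
exact: mxrankM_maxl.
Qed.

Lemma split_rank_prod W (I : finType) (p : I -> {mpoly F[n * d]}) :
  (\rank (M W (\prod_i p i)) <= \prod_i \rank (M W (p i)))%N.
Proof.
elim/big_rec2: _ => [|i r q _ le_r]; first exact: split_rank1.
by apply: leq_trans (split_rankM _ _ _) _; rewrite leq_mul2l le_r orbT.
Qed.

(** This symmetry turns the row bound below into the column bound. *)
Lemma split_mxC W p : M (~: W) p = (M W p)^T.
Proof.
apply/matrixP=> x y; rewrite !mxE; congr (meval (indicator_point F _) p).
by apply/ffunP=> j; rewrite !ffunE in_setC; case: (j \in W).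
Qed.

Lemma meval_indicator S p (c c' : {ffun 'I_d -> 'I_n}) :
  set_multilinear S p -> {in S, c =1 c'} ->
  p.@[indicator_point F c] = p.@[indicator_point F c'].
Proof.
move=> smp eq_c; rewrite !mevalE; apply: eq_big_seq => m /smp degm.
congr (_ * _); apply: eq_bigr => k _; case: (mxvec_indexP k) => i j.
rewrite /indicator_point !mxvecE !mxE; case: (boolP (j \in S)) => jS.
  by rewrite eq_c.
have /eqP := degm j; rewrite (negPf jS) sum_nat_eq0 => /forallP /(_ i) /eqP ->.
by rewrite !expr0.
Qed.

(** A row depends only on the restriction of its selection to [S :&: J :&: W]; the selections equal
    to [i0] elsewhere represent all these restrictions. *)
Lemma split_rank_row_bound W S p : set_multilinear S p ->
  (\rank (M W p) <= n ^ #|S :&: J :&: W|)%N.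
Proof.
move=> smp; pose Q := S :&: J :&: W.
pose C := [set a in pffun_on i0 (mem Q) (mem [set: 'I_n])].
have -> : (n ^ #|Q|)%N = #|[set enum_rank a | a in C]|.
  rewrite card_imset; last exact: enum_rank_inj.
  rewrite -[in LHS](card_ord n) -[in LHS]cardsT -(card_pffun_on i0).
  by apply: eq_card => a; rewrite [RHS]in_set.
apply: mxrank_le_card_rows => x.
exists (enum_rank [ffun j => if j \in Q then enum_val x j else i0]).
  apply: imset_f; rewrite inE; apply/pffun_onP; split=> [|j _]; last by rewrite inE.
  by apply/subsetP=> j; rewrite inE ffunE; case: ifP => //; rewrite eqxx.
apply/rowP=> y; rewrite !mxE enum_rankK; apply: meval_indicator smp _ => j jS.
by rewrite !ffunE !inE jS /=; case: (j \in J); case: (j \in W).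
Qed.

Lemma split_rank_col_bound W S p : set_multilinear S p ->
  (\rank (M W p) <= n ^ #|S :&: J :\: W|)%N.
Proof.
by move=> /(split_rank_row_bound (~: W)); rewrite split_mxC mxrank_tr -setDE.
Qed.

End SplitRank.

(** * Supports of set-multilinear polynomials *)

Lemma mxvec_index_eq (m n : nat) (i i' : 'I_m) (j j' : 'I_n) :
  (mxvec_index i j == mxvec_index i' j') = (i == i') && (j == j').
Proof.
apply/eqP/andP => [eq_ij|[/eqP-> /eqP->]] //.
have := mxvecE (\matrix_(a < m, b < n) (a, b)) i j.
by rewrite eq_ij mxvecE !mxE => -[-> ->]; rewrite !eqxx.
Qed.

Section SupportSet.
Variables (F : fieldType) (n d : nat).
Implicit Types (p : {mpoly F[n * d]}) (S : {set 'I_d}) (m : 'X_{1..n * d}).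

Definition block_degree m (j : 'I_d) : nat := (\sum_(i < n) m (mxvec_index i j))%N.

(** The set in [set_multilinear_formula] is only asserted to exist, and for 0 any set would do;
    reading it off the leading monomial makes a canonical choice, which is empty for 0. *)
Definition support_set p : {set 'I_d} := [set j | block_degree (mlead p) j == 1%N].

Lemma support_set_msupp S p m : set_multilinear S p -> m \in msupp p ->
  S = [set j | block_degree m j == 1%N].
Proof.
by move=> smp /smp degm; apply/setP=> j; rewrite inE /block_degree degm; case: (j \in S).
Qed.

Lemma support_setE S p : set_multilinear S p -> p != 0 -> support_set p = S.
Proof. by move=> smp /mlead_supp /(support_set_msupp smp). Qed.

Lemma set_multilinear_support S p :
  set_multilinear S p -> set_multilinear (support_set p) p.
Proof.
move=> smp; have [->|p0] := eqVneq p 0; last by rewrite (support_setE smp p0).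
by move=> m; rewrite msupp0.
Qed.

(** Polynomials with different supports share no monomial. A monomial surviving in the sum [h] of
    the other summands would be absent from the total, hence cancelled by a monomial of a summand
    with the right support, which is impossible. *)
Lemma support_set_sum (I : finType) (p : I -> {mpoly F[n * d]}) :
  (forall i, set_multilinear (support_set (p i)) (p i)) ->
  set_multilinear (support_set (\sum_i p i)) (\sum_i p i) ->
  \sum_i p i = \sum_(i | support_set (p i) == support_set (\sum_i p i)) p i.
Proof.
set f := \sum_i p i => smp smf; set S := support_set f.
have -> : f = \sum_(i | support_set (p i) == S) p i +
              \sum_(i | support_set (p i) != S) p i
  by rewrite /f (bigID (fun i => support_set (p i) == S)).
set g := \sum_(i | _ == _) _; set h := \sum_(i | _) _.
suff -> : h = 0 by rewrite addr0.
have fE : f = g + h by rewrite /f (bigID (fun i => support_set (p i) == S)).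
have sum_supp (P : pred I) m : m \in msupp (\sum_(i | P i) p i) ->
    exists2 i, P i & m \in msupp (p i).
  move=> /msupp_sum_le /flattenP[ms /mapP[i]].
  by rewrite mem_filter => /andP[Pi _] -> mi; exists i.
apply/eqP/negPn/negP=> h0; pose m := mlead h.
have mh : m \in msupp h by apply: mlead_supp.
have [i Si mi] := sum_supp _ _ mh.
have: m \notin msupp f.
  apply/negP=> /(support_set_msupp smf) SE.
  by rewrite (support_set_msupp (smp i) mi) -SE eqxx in Si.
rewrite mcoeff_msupp negbK fE mcoeffD addrC addr_eq0 => /eqP hg.
have: m \in msupp g by rewrite mcoeff_msupp -oppr_eq0 -hg -mcoeff_msupp.
move=> /sum_supp[k /eqP Sk mk].
rewrite (support_set_msupp (smp i) mi) in Si.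
by rewrite -Sk (support_set_msupp (smp k) mk) eqxx in Si.
Qed.

(** Leading monomials of nonzero factors multiply, so block degrees add up, and in the product they
    are 0 or 1. *)
Lemma support_set_prod (I : finType) (p : I -> {mpoly F[n * d]}) (j : 'I_d) :
  (forall i, set_multilinear (support_set (p i)) (p i)) ->
  set_multilinear (support_set (\prod_i p i)) (\prod_i p i) ->
  \prod_i p i != 0 ->
  (\sum_i (j \in support_set (p i)) = (j \in support_set (\prod_i p i)))%N.
Proof.
move=> smp smf f0.
have p0 i : p i != 0 by move: f0; apply: contraNneq => pi0; rewrite (bigD1 i) //= pi0 mul0r.
rewrite -(smf _ (mlead_supp f0)) mlead_prod //.
under [RHS]eq_bigr do rewrite mnm_sumE.
by rewrite exchange_big; apply: eq_bigr => i _; rewrite -(smp i _ (mlead_supp (p0 i))).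
Qed.

Lemma support_set_prod_disjoint (I : finType) (p : I -> {mpoly F[n * d]}) :
  (forall i, set_multilinear (support_set (p i)) (p i)) ->
  set_multilinear (support_set (\prod_i p i)) (\prod_i p i) ->
  \prod_i p i != 0 ->
  forall i k, i != k -> [disjoint support_set (p i) & support_set (p k)].
Proof.
move=> smp smf f0 i k ik; apply/pred0P=> j /=; apply/negbTE/andP=> -[ji jk].
have := support_set_prod j smp smf f0.
by rewrite (bigD1 i) //= (bigD1 k) 1?eq_sym //= ji jk; case: (_ \in _).
Qed.

Lemma card_support_set_prod (I : finType) (p : I -> {mpoly F[n * d]}) (J : {set 'I_d}) :
  (forall i, set_multilinear (support_set (p i)) (p i)) ->
  set_multilinear (support_set (\prod_i p i)) (\prod_i p i) ->
  \prod_i p i != 0 ->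
  #|support_set (\prod_i p i) :&: J| = (\sum_i #|support_set (p i) :&: J|)%N.
Proof.
move=> smp smf f0.
have cardE (S : {set 'I_d}) : #|S :&: J| = (\sum_(j in J) (j \in S))%N.
  by rewrite -sum1_card big_mkcond [RHS]big_mkcond; apply: eq_bigr => j _;
    rewrite inE andbC; case: (j \in J) => //=; case: (j \in S).
rewrite cardE; under [RHS]eq_bigr do rewrite cardE.
rewrite exchange_big; apply: eq_bigr => j _.
by rewrite support_set_prod.
Qed.

Lemma set_multilinear_feval (t : formula F n d) :
  set_multilinear_formula t -> set_multilinear (support_set (feval t)) (feval t).
Proof. by case: t => [i j|a|k g|k g] /= [[S]] /set_multilinear_support. Qed.

Lemma block_degree_xvar i j m : m \in msupp (xvar F i j) ->
  forall j', block_degree m j' = (j' == j).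
Proof.
rewrite msuppX inE => /eqP -> j'; rewrite /block_degree.
under eq_bigr do rewrite mnm1E mxvec_index_eq.
have [_|_] := eqVneq j' j; last by rewrite big1 // => i' _; rewrite andbF.
rewrite (bigD1 i) //= eqxx big1 // => i'.
by rewrite eq_sym => /negPf -> /=.
Qed.

Lemma card_support_set_xvar i j : (#|support_set (xvar F i j)| <= 1)%N.
Proof.
rewrite -(cards1 j); apply/subset_leq_card/subsetP=> j'; rewrite !inE.
have x0 : xvar F i j != 0 by rewrite -msupp_eq0 msuppX.
by rewrite (block_degree_xvar (mlead_supp x0)); case: (j' == j).
Qed.

Lemma support_setC (a : F) : support_set a%:MP = set0.
Proof.
apply/setP=> j; rewrite !inE mleadC /block_degree big1 // => i _.
by rewrite mnm0E.
Qed.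

(** Such a formula only adds up variables and constants, and some nonzero summand has the support of
    the whole sum. *)
Lemma card_support_set_depth0 (t : formula F n d) : set_multilinear_formula t ->
  feval t != 0 -> product_depth t = 0%N -> (#|support_set (feval t)| <= 1)%N.
Proof.
elim: t => [i j|a|k g IH|k g _] //=; first by rewrite card_support_set_xvar.
  by rewrite support_setC cards0.
move=> smt f0 /eqP; rewrite -leqn0 => /bigmax_leqP dg.
have smg i := set_multilinear_feval (smt.2 i).
have fE := support_set_sum smg (set_multilinear_feval (smt : set_multilinear_formula (FSum g))).
have [i /andP[/eqP Si gi0]] :
    exists i, (support_set (feval (g i)) == support_set (\sum_i feval (g i)))
      && (feval (g i) != 0).
  apply/existsP; apply: contraR f0; rewrite negb_exists => /forallP all0.
  rewrite [X in X == _]fE big1 // => i Si; have := all0 i.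
  by rewrite Si /= negbK => /eqP.
by rewrite -Si; apply: IH => //; [apply: smt.2|apply/eqP; rewrite -leqn0 dg].
Qed.

End SupportSet.

(** * Averages over a uniformly random subset *)

Lemma coef_XD1_exp (R : nzRingType) (b m : nat) :
  (('X + 1 : {poly R}) ^+ b)`_m = 'C(b, m)%:R.
Proof.
rewrite exprD1n coef_sum; have [mb|bm] := leqP m b.
  rewrite (bigD1 (Ordinal (mb : m < b.+1)%N)) //= coefMn coefXn eqxx big1 ?addr0 //.
  move=> i; rewrite -val_eqE /= => im.
  by rewrite coefMn coefXn eq_sym (negPf im) mul0rn.
rewrite bin_small // big1 // => i _.
by rewrite coefMn coefXn gtn_eqF ?mul0rn // (leq_trans _ bm).
Qed.

Lemma card_all_subsets (T : finType) : #|{: {set T}}| = (2 ^ #|T|)%N.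
Proof. by rewrite -[LHS]cardsT -powersetT card_powerset cardsT. Qed.

Section SubsetMean.
Variables (R : realFieldType) (T : finType).
Implicit Types (f g : {set T} -> R) (A Q W : {set T}).

Definition subset_mean f : R := (2 ^+ #|T|)^-1 * \sum_W f W.

Lemma pow2_gt0 k : 0 < 2 ^+ k :> R. Proof. by rewrite exprn_gt0. Qed.

Lemma subset_mean_cst c : subset_mean (fun=> c) = c.
Proof.
rewrite /subset_mean sumr_const card_all_subsets.
by rewrite -[X in _ * X]mulr_natl natrX mulrA mulVf ?mul1r // gt_eqF // pow2_gt0.
Qed.

Lemma subset_mean_eq f g : f =1 g -> subset_mean f = subset_mean g.
Proof. by move=> fg; congr (_ * _); apply: eq_bigr. Qed.

Lemma subset_mean_le f g : (forall W, f W <= g W) -> subset_mean f <= subset_mean g.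
Proof.
by move=> fg; rewrite ler_pM2l ?invr_gt0 ?pow2_gt0 //; apply: ler_sum.
Qed.

Lemma subset_mean_ge0 f : (forall W, 0 <= f W) -> 0 <= subset_mean f.
Proof. by move=> /subset_mean_le; rewrite subset_mean_cst. Qed.

Lemma subset_mean_sum (I : finType) (P : pred I) (f : I -> {set T} -> R) :
  subset_mean (fun W => \sum_(i | P i) f i W) = \sum_(i | P i) subset_mean (f i).
Proof. by rewrite /subset_mean exchange_big mulr_sumr. Qed.

Lemma subset_meanD f g :
  subset_mean (fun W => f W + g W) = subset_mean f + subset_mean g.
Proof. by rewrite /subset_mean big_split mulrDr. Qed.

Lemma subset_meanZ c f : subset_mean (fun W => c * f W) = c * subset_mean f.
Proof. by rewrite /subset_mean -mulr_sumr mulrCA. Qed.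

(* Exchanging the parts of W and W' outside A is a bijection of the pairs (W, W'). *)
Lemma subset_meanM A f g :
  (forall W, f W = f (W :&: A)) -> (forall W, g W = g (W :\: A)) ->
  subset_mean (fun W => f W * g W) = subset_mean f * subset_mean g.
Proof.
move=> fA gA; pose U (x : {set T} * {set T}) := (x.1 :&: A) :|: (x.2 :\: A).
pose s x := (U x, U (x.2, x.1)).
have sK : involutive s.
  move=> [W W']; congr (_, _); apply/setP=> x; rewrite !inE /=;
  by case: (x \in A); rewrite ?andbT ?andbF ?orbF.
have sumE : (\sum_W f W) * (\sum_W g W) = 2 ^+ #|T| * \sum_W f W * g W.
  rewrite mulr_suml; under eq_bigr do rewrite mulr_sumr.
  rewrite pair_bigA (reindex_inj (inv_inj sK)) /=.
  have -> : 2 ^+ #|T| * \sum_W f W * g W = \sum_(x : {set T} * {set T}) f x.1 * g x.1.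
    rewrite -(pair_bigA _ (fun W W' => f W * g W)) /= mulr_sumr.
    by apply: eq_bigr => W _; rewrite sumr_const -[RHS]mulr_natl card_all_subsets natrX.
  apply: eq_bigr => -[W W'] _ /=; rewrite fA gA [f W]fA [g W]gA; congr (f _ * g _).
    by apply/setP=> x; rewrite !inE; case: (x \in A); rewrite ?andbT ?andbF ?orbF.
  by apply/setP=> x; rewrite !inE; case: (x \in A); rewrite ?andbT ?andbF ?orbF.
rewrite /subset_mean mulrACA sumE -[in RHS]mulrA.
by rewrite mulKf ?gt_eqF ?pow2_gt0.
Qed.

(** Independence of the traces of a random [W] on disjoint sets, by induction from
    [subset_meanM]. *)
Lemma subset_mean_prod k (Q : 'I_k -> {set T}) (f : 'I_k -> {set T} -> R) :
  (forall i j, i != j -> [disjoint Q i & Q j]) ->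
  (forall i W, f i W = f i (W :&: Q i)) ->
  subset_mean (fun W => \prod_i f i W) = \prod_i subset_mean (f i).
Proof.
elim: k Q f => [|k IH] Q f disQ fQ.
  by rewrite big_ord0 (@subset_mean_eq _ (fun=> 1)) ?subset_mean_cst // => W; rewrite big_ord0.
rewrite big_ord_recl -(IH (fun i => Q (lift ord0 i))) //; last first.
  by move=> i j ij; apply: disQ; rewrite (inj_eq lift_inj).
rewrite -(@subset_meanM (Q ord0)) //; first by apply: subset_mean_eq => W; rewrite big_ord_recl.
move=> W; apply: eq_bigr => i _; rewrite fQ [RHS]fQ; congr (f _ _).
apply/setP=> x; rewrite !inE; case: (boolP (x \in Q ord0)) => //= x0.
rewrite [in LHS](_ : x \in Q (lift ord0 i) = false) ?andbF //.
by apply: (disjointFr (disQ ord0 (lift ord0 i) _)).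
Qed.

(** Coefficient extraction from the generating polynomial of [#|W :&: Q|]: each point of [Q]
    contributes [1 + 'X], any other point contributes 2. *)
Lemma card_subsets_meeting Q m :
  #|[set W : {set T} | #|W :&: Q| == m]| = ('C(#|Q|, m) * 2 ^ (#|T| - #|Q|))%N.
Proof.
pose P : {poly int} := \sum_(W : {set T}) 'X^#|W :&: Q|.
have PE : P = (1 + 'X) ^+ #|Q| * (2 ^ (#|T| - #|Q|))%:R.
  transitivity (\prod_(x : T) ((if x \in Q then 'X else 1) + 1) : {poly int}).
    rewrite bigA_distr; apply: eq_bigr => W _.
    rewrite -big_mkcond -big_mkcondr /= prodr_const; congr (_ ^+ _).
    by apply: eq_card => x; rewrite !inE.
  rewrite (bigID (mem Q)) /= (eq_bigr (fun=> 1 + 'X)) => [|x ->]; last exact: addrC.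
  rewrite prodr_const [X in _ * X](eq_bigr (fun=> 2)) => [|x /negPf ->] //.
  rewrite prodr_const natrX; congr (_ * _ ^+ _).
  by rewrite -(cardsC Q) addKn; apply: eq_card => x; rewrite !inE.
have : P`_m = (#|[set W : {set T} | #|W :&: Q| == m]|)%:R.
  rewrite coef_sum -sum1_card natr_sum big_mkcond [RHS]big_mkcond /=.
  by apply: eq_bigr => W _; rewrite coefXn inE eq_sym; case: eqP.
by rewrite PE mulr_natr coefMn addrC coef_XD1_exp -mulrnA !natz => -[<-].
Qed.

End SubsetMean.

(** * Estimates for the central binomial coefficient *)

Lemma central_binS m : ('C(m.+1.*2, m.+1) * m.+1 = 'C(m.*2, m) * (m.*2.+1).*2)%N.
Proof.
have := mul_bin_diag m.+1.*2 m; have := mul_bin_down m.*2.+1 m.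
rewrite /= doubleS /= (_ : m.*2.+1 - m = m.+1)%N; last lia.
lia.
Qed.

Section CentralBinomial.
Variable (R : realFieldType).

(** The probability that 2m fair coins show m heads. *)
Definition central_prob m : R := ('C(m.*2, m))%:R / 4 ^+ m.

Lemma central_probS m :
  central_prob m.+1 * (2 * m%:R + 2) = central_prob m * (2 * m%:R + 1).
Proof.
have E : 'C(m.+1.*2, m.+1)%:R * (m%:R + 1) = 'C(m.*2, m)%:R * (2 * (2 * m%:R + 1)) :> R.
  rewrite natr1 -natrM central_binS natrM -[(_.+1).*2]muln2 natrM.
  by rewrite -[m.*2.+1%:R]natr1 -[in m.*2%:R]muln2 natrM; ring.
rewrite /central_prob exprS invfM; move: (4 ^+ m)^-1 => z.
have -> : 'C(m.+1.*2, m.+1)%:R * (4^-1 * z) * (2 * m%:R + 2) =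
  'C(m.+1.*2, m.+1)%:R * (m%:R + 1) * (2^-1 * z) by field.
by rewrite E; field.
Qed.

Lemma central_prob_ge0 m : 0 <= central_prob m.
Proof. by rewrite divr_ge0 // exprn_ge0. Qed.

(** The ratio of consecutive terms is (2m + 1) / (2m + 2), and (2m + 1)(2m + 3) is at most the
    square of 2m + 2. *)
Lemma central_prob_sqr_le m : central_prob m ^+ 2 * (2 * m%:R + 1) <= 1.
Proof.
elim: m => [|m IH]; first by rewrite /central_prob bin0 expr0; lra.
have := central_probS m; set p := central_prob m in IH *.
set q := central_prob m.+1; rewrite -[m.+1%:R]natr1 => E.
have m0 : 0 <= m%:R :> R by [].
rewrite -(ler_pM2r (_ : 0 < (2 * m%:R + 2) ^+ 2)); last by rewrite exprn_gt0 //; lra.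
rewrite mulrAC -exprMn E exprMn; nra.
Qed.

Lemma central_prob_ge m : 1 <= central_prob m * (2 * m%:R + 1).
Proof.
elim: m => [|m IH]; first by rewrite /central_prob bin0 expr0; lra.
have := central_probS m; set p := central_prob m in IH *.
set q := central_prob m.+1; rewrite -[m.+1%:R]natr1 => E.
have m0 : 0 <= m%:R :> R by [].
rewrite -(ler_pM2r (_ : 0 < 2 * m%:R + 2)); last lra.
by rewrite mulrAC E; nra.
Qed.

End CentralBinomial.

(** * Imbalance of a random split *)

(** An absolute difference: at most one of the two truncated subtractions is nonzero. *)
Definition imbalance (T : finType) (Q W : {set T}) : nat :=
  (#|Q :&: W| - #|Q :\: W| + (#|Q :\: W| - #|Q :&: W|))%N.

Lemma imbalance_setI (T : finType) (Q W : {set T}) :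
  imbalance Q W = imbalance Q (W :&: Q).
Proof.
rewrite /imbalance.
have -> : Q :&: (W :&: Q) = Q :&: W by rewrite setICA setIid setIC.
suff -> : Q :\: (W :&: Q) = Q :\: W by [].
by apply/setP=> x; rewrite !inE; case: (x \in Q); rewrite ?andbF ?andbT.
Qed.

Lemma imbalance_eq0 (T : finType) (Q W : {set T}) :
  (imbalance Q W == 0%N) = (#|W :&: Q| == #|Q|./2) && ~~ odd #|Q|.
Proof. by rewrite /imbalance setIC -(cardsID W Q) setIC; lia. Qed.

Section MeanImbalance.
Variables (R : realFieldType) (T : finType).
Implicit Types (Q W : {set T}).

Lemma balanced_prob Q : ~~ odd #|Q| ->
  subset_mean (fun W => (imbalance Q W == 0%N)%:R) = central_prob R #|Q|./2.
Proof.
move=> Qeven; have QT : (#|Q| <= #|T|)%N by apply: max_card.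
rewrite /subset_mean.
rewrite (eq_bigr (fun W => (W \in [set W | #|W :&: Q| == #|Q|./2])%:R)); last first.
  by move=> W _; rewrite imbalance_eq0 Qeven andbT inE.
set A := [set W | _].
have -> : \sum_W (W \in A)%:R = #|A|%:R :> R.
  rewrite -[#|A|]sum1_card natr_sum [RHS]big_mkcond /=.
  by apply: eq_bigr => W _; case: ifP.
rewrite card_subsets_meeting; move: QT (odd_double_half #|Q|); rewrite (negPf Qeven) add0n.
move: #|Q|./2 => h QT QE; rewrite -QE in QT *.
rewrite /central_prob natrM natrX -{1}(subnK QT) exprD mulrC -mulrA; congr (_ * _).
rewrite invfM mulrA mulfV ?mul1r ?expf_neq0 //.
by rewrite -mul2n exprM -natrX.
Qed.

Lemma balanced_prob_sqr_le Q :
  subset_mean (fun W => (imbalance Q W == 0%N)%:R : R) ^+ 2 * (1 + #|Q|%:R) <= 1.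
Proof.
case: (boolP (odd #|Q|)) => [Qodd|Qeven].
  rewrite (@subset_mean_eq _ _ _ (fun=> 0)) ?subset_mean_cst ?expr0n ?mul0r //.
  by move=> W; rewrite imbalance_eq0 Qodd andbF.
rewrite balanced_prob //.
have -> : 1 + #|Q|%:R = 2 * #|Q|./2%:R + 1 :> R.
  by rewrite -{1}[#|Q|]odd_double_half (negPf Qeven) add0n -mul2n natrM addrC.
exact: central_prob_sqr_le.
Qed.

(** Here [y] is [(1 + #|Q|) ^ (- 1 / 4)]. A balanced [W], of probability [P] at most [y ^+ 2],
    contributes 1 and any other at most [v], so the mean is at most [v + (1 - v) * y ^+ 2]. *)
Lemma subset_mean_imbalance_le Q (v y : R) :
  0 <= v -> v <= 4^-1 -> v ^+ 2 * (1 + #|Q|%:R) <= 4 ->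
  0 <= y -> y ^+ 4 * (1 + #|Q|%:R) = 1 ->
  subset_mean (fun W => v ^+ imbalance Q W) <= y.
Proof.
move=> v0 v1 vQ y0 yQ; have Q0 : 0 <= #|Q|%:R :> R by [].
pose P : R := subset_mean (fun W => (imbalance Q W == 0%N)%:R).
have P0 : 0 <= P by apply: subset_mean_ge0.
have Py : P <= y ^+ 2.
  have PQ : P ^+ 2 * (1 + #|Q|%:R) <= 1 := balanced_prob_sqr_le Q.
  rewrite -(@ler_pXn2r _ 2) ?nnegrE ?exprn_ge0 // -exprM -[(2 * 2)%N]/4%N.
  by rewrite -(ler_pM2r (_ : 0 < 1 + #|Q|%:R)) ?yQ //; lra.
have vy : v <= 2 * y ^+ 2.
  rewrite -(@ler_pXn2r _ 2) ?nnegrE ?mulr_ge0 ?exprn_ge0 // exprMn -exprM -[(2 * 2)%N]/4%N.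
  rewrite -(ler_pM2r (_ : 0 < 1 + #|Q|%:R)); last lra.
  by rewrite -[leRHS]mulrA yQ mulr1 (le_trans vQ) // -natrX.
have y1 : y <= 1.
  rewrite -(@ler_pXn2r _ 4) ?nnegrE // expr1n.
  by rewrite -(ler_pM2r (_ : 0 < 1 + #|Q|%:R)) ?yQ //; lra.
have le_mean : subset_mean (fun W => v ^+ imbalance Q W) <= v + (1 - v) * P.
  rewrite -subset_meanZ -{2}(subset_mean_cst T v) -subset_meanD.
  apply: subset_mean_le => W; have [->|i0] := eqVneq (imbalance Q W) 0%N.
    by rewrite expr0 ?eqxx mulr1; lra.
  rewrite mulr0 addr0 -[leRHS]expr1; apply: ler_wiXn2l => //; last by rewrite lt0n.
  lra.
apply: le_trans le_mean _; apply: (@le_trans _ _ (v + (1 - v) * y ^+ 2)).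
  by rewrite lerD2l ler_wpM2l //; lra.
(* For [y] at most 1/3, [v <= 2 * y ^+ 2] bounds the mean by [3 * y ^+ 2]; for larger [y],
   [v <= 1/4] leaves [1/4 + 3/4 * y ^+ 2 <= y], that is (3y - 1)(1 - y) nonnegative. *)
have [y3|/ltW y3] := leP y 3^-1.
  have : 0 <= y * (3^-1 - y) by rewrite mulr_ge0 // subr_ge0.
  have : 0 <= v * y ^+ 2 by rewrite mulr_ge0 // exprn_ge0.
  by move: vy; rewrite expr2; lra.
have y21 : y ^+ 2 <= 1 by rewrite expr_le1.
have : 0 <= (4^-1 - v) * (1 - y ^+ 2) by rewrite mulr_ge0 // subr_ge0.
have : 0 <= (y - 3^-1) * (1 - y) by rewrite mulr_ge0 // subr_ge0.
by rewrite expr2; lra.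
Qed.

(* Both rank bounds give r <= n ^ min(a, b), and v = n ^ (-1/2). *)
Lemma normalized_rank_le (n r : nat) (v : R) (Q W : {set T}) :
  0 <= v -> n%:R * v ^+ 2 = 1 ->
  (r <= n ^ #|Q :&: W|)%N -> (r <= n ^ #|Q :\: W|)%N ->
  r%:R * v ^+ #|Q| <= v ^+ imbalance Q W.
Proof.
move=> v0 nv; rewrite -(cardsID W Q) /imbalance.
move: #|Q :&: W| #|Q :\: W| => a b.
wlog ab : a b / (a <= b)%N => [IH ra rb|ra _].
  have [ab|/ltnW ba] := leqP a b; first exact: IH.
  by rewrite (addnC a) (addnC (a - b)%N); apply: IH.
rewrite (eqP (ab : (a - b == 0)%N)) add0n -{1}(subnKC ab) addnA addnn -mul2n exprD.
rewrite mulrA ler_piMl ?exprn_ge0 //.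
apply: (@le_trans _ _ ((n ^ a)%:R * v ^+ (2 * a))).
  by rewrite ler_wpM2r ?exprn_ge0 // ler_nat.
by rewrite natrX exprM -exprMn nv expr1n.
Qed.

End MeanImbalance.

(** * Mean normalized rank of a formula *)

Lemma ln_onep_chord (R : realType) (b B : R) : 0 <= b -> b <= B ->
  b * ln (1 + B) <= B * ln (1 + b).
Proof.
move=> b0 bB; have [B0|B0] := eqVneq B 0; first by rewrite B0 in bB *; rewrite (_ : b = 0) ?mul0r //; lra.
have Bgt : 0 < B by rewrite lt_neqAle eq_sym B0 (le_trans b0).
have t0 : 0 <= b / B by rewrite divr_ge0 // ltW.
have t1 : b / B <= 1 by rewrite ler_pdivrMr // mul1r.
(* [1 + b] is the convex combination of [1 + B] and 1 with weight [b / B], and [ln 1] vanishes. *)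
have := @concave_ln R (Itv01 t0 t1) (1 + B) 1.
rewrite !convex.convRE /= /unstable.onem ln1 mulr0 addr0 mulr1 => H.
have {}H : b / B * ln (1 + B) <= ln (1 + b).
  have -> : 1 + b = b / B * (1 + B) + (1 - b / B) by field.
  by apply: H; lra.
by rewrite -ler_pdivrMl // mulrA [_^-1 * _]mulrC.
Qed.

Section MeanRank.
Variables (R : realType) (F : fieldType) (n d : nat) (i0 : 'I_n) (J : {set 'I_d}).
Variables (v q : R).
Hypotheses (v0 : 0 <= v) (v4 : v <= 4^-1) (nv : n%:R * v ^+ 2 = 1).
Hypotheses (dn : (d <= n)%N) (q1 : 1 <= q) (qn : q <= n%:R).
Implicit Types (p : {mpoly F[n * d]}) (W : {set 'I_d}).

Notation supp p := (support_set p :&: J).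

Definition nrank p W : R := (\rank (split_mx i0 J W p))%:R * v ^+ #|supp p|.

Lemma nrank_ge0 p W : 0 <= nrank p W.
Proof. by rewrite mulr_ge0 ?exprn_ge0. Qed.

Lemma nrank_le_imbalance p W : set_multilinear (support_set p) p ->
  nrank p W <= v ^+ imbalance (supp p) W.
Proof.
move=> smp; apply: normalized_rank_le nv _ _ => //.
  exact: split_rank_row_bound.
exact: split_rank_col_bound.
Qed.

Lemma v_le1 : v <= 1. Proof. by apply: le_trans v4 _; lra. Qed.

Lemma nrank_le1 p W : set_multilinear (support_set p) p -> nrank p W <= 1.
Proof. by move=> /(nrank_le_imbalance W) /le_trans -> //; rewrite exprn_ile1 // v_le1. Qed.

Lemma nrank0 W : nrank 0 W = 0.
Proof.
rewrite /nrank (_ : split_mx i0 J W 0 = 0) ?mxrank0 ?mul0r //.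
by apply/matrixP=> x y; rewrite !mxE rmorph0.
Qed.

Lemma nrank_sum (I : finType) (p : I -> {mpoly F[n * d]}) W :
  (forall i, set_multilinear (support_set (p i)) (p i)) ->
  set_multilinear (support_set (\sum_i p i)) (\sum_i p i) ->
  nrank (\sum_i p i) W <=
    \sum_(i | support_set (p i) == support_set (\sum_i p i)) nrank (p i) W.
Proof.
move=> smp smf; rewrite {1}/nrank {1}(support_set_sum smp smf) split_mx_sum.
rewrite (eq_bigr (fun i => (\rank (split_mx i0 J W (p i)))%:R *
    v ^+ #|supp (\sum_i p i)|)); last by move=> i /eqP Si; rewrite /nrank Si.
by rewrite -mulr_suml ler_wpM2r ?exprn_ge0 // -natr_sum ler_nat mxrank_sum_le.
Qed.

Lemma nrank_prod (I : finType) (p : I -> {mpoly F[n * d]}) W :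
  (forall i, set_multilinear (support_set (p i)) (p i)) ->
  set_multilinear (support_set (\prod_i p i)) (\prod_i p i) ->
  \prod_i p i != 0 -> nrank (\prod_i p i) W <= \prod_i nrank (p i) W.
Proof.
move=> smp smf f0; rewrite /nrank card_support_set_prod // expr_sum big_split /=.
rewrite ler_wpM2r ?prodr_ge0 // => [i _|]; first by rewrite exprn_ge0.
by rewrite -natr_prod ler_nat split_rank_prod.
Qed.

(** This is [(1 + q) ^ (- q / 4)]. *)
Definition rank_decay : R := expR (- (q * ln (1 + q) / 4)).

Lemma subset_mean_imbalance_expR (Q : {set 'I_d}) :
  subset_mean (fun W => v ^+ imbalance Q W) <= expR (- (ln (1 + #|Q|%:R) / 4)).
Proof.
have Q0 : 0 < 1 + #|Q|%:R :> R by rewrite ltr_pwDl.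
apply: subset_mean_imbalance_le => //.
- have : 1 + #|Q|%:R <= 2 * n%:R :> R.
    have : (1 + #|Q| <= 2 * n)%N.
      have Qd : (#|Q| <= d)%N by rewrite -[leqRHS]card_ord max_card.
      by have := ltn_ord i0; lia.
    by rewrite -(ler_nat R) natrD natrM.
  have v20 : 0 <= v ^+ 2 by rewrite exprn_ge0.
  by move=> /(ler_wpM2l v20); rewrite mulrCA [v ^+ 2 * n%:R]mulrC nv; lra.
rewrite -expRM_natl.
have -> : 4 * - (ln (1 + #|Q|%:R) / 4) = - ln (1 + #|Q|%:R) :> R by field.
by rewrite expRN lnK ?posrE // mulVf // gt_eqF.
Qed.

(** The chord bound [ln (1 + b i) >= (b i / B) * ln (1 + B)], summed over [i], gives at least
    [q * ln (1 + B)], hence at least [q * ln (1 + q)]. *)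
Lemma prod_decay k (b : 'I_k -> nat) (B : R) : q <= B ->
  (forall i, (b i)%:R <= B) -> q * B <= (\sum_i b i)%:R ->
  \prod_i expR (- (ln (1 + (b i)%:R) / 4)) <= rank_decay.
Proof.
move=> qB bB sumb; rewrite -expR_sum ler_expR sumrN lerN2 -mulr_suml ler_pM2r ?invr_gt0 //.
have q0 : 0 < q := lt_le_trans ltr01 q1.
have B0 : 0 < B by lra.
have lnqB : ln (1 + q) <= ln (1 + B) by rewrite ler_ln ?posrE; lra.
have lnq : 0 <= ln (1 + q) by rewrite ln_ge0 //; lra.
rewrite -(ler_pM2l B0) mulr_sumr.
apply: (@le_trans _ _ (\sum_i (b i)%:R * ln (1 + B))); last first.
  by apply: ler_sum => i _; apply: ln_onep_chord.
rewrite -mulr_suml -natr_sum mulrA [B * q]mulrC.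
by apply: ler_pM => //; rewrite mulr_ge0 //; lra.
Qed.

(** As [v] is [n ^ (- 1 / 2)], this amounts to [1 + q <= n ^ 2], which follows from [q <= n] and
    [n >= 2]. *)
Lemma expr_le_decay (b : nat) : q <= b%:R -> v ^+ b <= rank_decay.
Proof.
move=> qb; have q0 : 0 < q := lt_le_trans ltr01 q1.
have n0 : 0 < n%:R :> R by rewrite ltr0n (leq_ltn_trans _ (ltn_ord i0)).
have vgt0 : 0 < v.
  by rewrite lt_neqAle v0 andbT; apply: contraPneq nv => <-;
     rewrite expr0n mulr0 => /esym/eqP; rewrite oner_eq0.
have lnv : ln v = - (ln n%:R / 2).
  have : ln (n%:R * v ^+ 2) = 0 by rewrite nv ln1.
  by rewrite lnM ?posrE ?exprn_gt0 // lnXn // -mulr_natr; lra.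
have ln_le : ln (1 + q) <= 2 * ln n%:R.
  rewrite mulr_natl -lnXn // ler_ln ?posrE ?exprn_gt0 //; last lra.
  have n2 : 2 <= n%:R :> R.
    rewrite ler_nat ltnNge; apply/negP => n1.
    have : n%:R <= 1 :> R by rewrite (ler_nat R n 1).
    have : v ^+ 2 <= 4^-1 * 1 by rewrite expr2 ler_pM ?v_le1.
    have : 0 <= v ^+ 2 by rewrite exprn_ge0.
    by have := nv; nra.
  have qn' : q <= n%:R := qn.
  by rewrite expr2; nra.
have lnq : 0 <= ln (1 + q) by rewrite ln_ge0 //; lra.
rewrite -[v in v ^+ b]lnK ?posrE // -expRM_natl ler_expR lnv.
rewrite mulrN lerN2.
have : q * ln (1 + q) <= b%:R * (2 * ln n%:R) by apply: ler_pM => //; lra.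
lra.
Qed.

(** Induction on the formula, with [delta] only an upper bound on the depth so that sum nodes keep
    it. Leaves are excluded because [q ^+ delta] exceeds 1; a product node lowers [delta] by one. *)
Lemma formula_mean_nrank (t : formula F n d) (delta : nat) :
  set_multilinear_formula t -> (product_depth t <= delta)%N -> (0 < delta)%N ->
  1 < q -> q ^+ delta <= #|supp (feval t)|%:R ->
  subset_mean (nrank (feval t)) <= (fsize t)%:R * rank_decay.
Proof.
move=> + + + qgt1; have q0 : 0 < q := lt_le_trans ltr01 q1.
elim: t delta => [i j|a|k g IH|k g IH] delta smt dt d0 qt.
- have qd1 : 1 < q ^+ delta by rewrite exprn_egt1 // -lt0n.
  have : q ^+ delta <= 1.
    apply: le_trans qt _; rewrite -[leRHS]/1%:R ler_nat.
    apply: leq_trans (card_support_set_xvar F i j).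
    exact/subset_leq_card/subsetIl.
  by rewrite leNgt qd1.
- by move: qt; rewrite /= support_setC set0I cards0 leNgt exprn_gt0.
- have smf := set_multilinear_feval smt.
  have smg i := set_multilinear_feval (smt.2 i).
  rewrite /= in smf qt *.
  apply: le_trans (subset_mean_le (fun W => nrank_sum W smg smf)) _.
  rewrite subset_mean_sum.
  apply: (@le_trans _ _ (\sum_i (fsize (g i))%:R * rank_decay)); last first.
    by rewrite -mulr_suml -natr_sum ler_wpM2r ?expR_ge0 // ler_nat.
  rewrite big_mkcond; apply: ler_sum => i _; case: ifP => [/eqP Si|_]; last first.
    by rewrite mulr_ge0 ?expR_ge0.
  apply: IH (smt.2 i) _ d0 _; last by rewrite Si.
  by apply: leq_trans dt; rewrite /= (leq_bigmax i).
have smf := set_multilinear_feval smt.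
have smg i := set_multilinear_feval (smt.2 i).
rewrite /= in smf qt dt *.
have size0 : 0 <= (\sum_i fsize (g i)).+1%:R * rank_decay by rewrite mulr_ge0 ?expR_ge0.
have [->|f0] := eqVneq (\prod_i feval (g i)) 0.
  by rewrite (subset_mean_eq nrank0) subset_mean_cst.
have le_prod W := nrank_prod W smg smf f0.
case: delta d0 dt qt => // delta _; rewrite ltnS => /bigmax_leqP dg.
rewrite card_support_set_prod // => qt.
have size1 : rank_decay <= (\sum_i fsize (g i)).+1%:R * rank_decay.
  by rewrite ler_peMl ?expR_ge0 // ler1n.
have [delta0|delta_gt0] := posnP delta.
  apply: le_trans size1.
  have g0 i : feval (g i) != 0.
    by apply: contraNneq f0 => gi0; rewrite (bigD1 i) //= gi0 mul0r.
  have supp1 i : (#|supp (feval (g i))| <= 1)%N.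
    apply: leq_trans (subset_leq_card (subsetIl _ _)) _.
    apply: card_support_set_depth0 (smt.2 i) (g0 i) _.
    by apply/eqP; rewrite -leqn0 -delta0 dg.
  rewrite delta0 expr1 in qt.
  apply: le_trans (expr_le_decay qt).
  rewrite -[leRHS](subset_mean_cst 'I_d); apply: subset_mean_le => W.
  apply: le_trans (le_prod W) _; rewrite expr_sum; apply: ler_prod => i _.
  rewrite nrank_ge0 (le_trans (nrank_le_imbalance W (smg i))) //.
  have -> // : imbalance (supp (feval (g i))) W = #|supp (feval (g i))|.
  by have := supp1 i; rewrite /imbalance -(cardsID W (supp (feval (g i)))); lia.
(* A factor on many blocks carries the induction, the other factors being at most 1; otherwise all
   factors are small and independence applies with [B] equal to [q ^+ delta]. *)
case: (boolP [exists i, q ^+ delta <= #|supp (feval (g i))|%:R]) => [/existsP[i qi]|].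
  apply: (@le_trans _ _ ((fsize (g i))%:R * rank_decay)).
    apply: le_trans (IH i delta (smt.2 i) (dg i isT) delta_gt0 qi).
    apply: subset_mean_le => W; apply: le_trans (le_prod W) _.
    rewrite (bigD1 i) //= ler_piMr ?nrank_ge0 // prodr_ile1 // => i' _.
    by rewrite nrank_ge0 nrank_le1.
  by rewrite ler_wpM2r ?expR_ge0 // ler_nat leqW // (bigD1 i) //= leq_addr.
rewrite negb_exists => /forallP smallg; apply: le_trans size1.
have disg i i' : i != i' -> [disjoint supp (feval (g i)) & supp (feval (g i'))].
  move=> ii'; apply: disjointWl (subsetIl _ _) _; apply: disjointWr (subsetIl _ _) _.
  exact: support_set_prod_disjoint smg smf f0 _ _ ii'.
apply: (@le_trans _ _ (subset_mean (fun W =>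
    \prod_i v ^+ imbalance (supp (feval (g i))) W))).
  apply: subset_mean_le => W; apply: le_trans (le_prod W) _; apply: ler_prod => i _.
  by rewrite nrank_ge0 nrank_le_imbalance.
rewrite (subset_mean_prod (f := fun i W => v ^+ imbalance (supp (feval (g i))) W) disg);
  last by move=> i W; rewrite imbalance_setI.
apply: le_trans (@prod_decay _ (fun i => #|supp (feval (g i))|) (q ^+ delta) _ _ _).
- apply: ler_prod => i _; rewrite subset_mean_imbalance_expR andbT.
  by apply: subset_mean_ge0 => W; rewrite exprn_ge0.
- by rewrite -[leLHS]expr1 ler_weXn2l // ltW.
- by move=> i; apply: ltW; rewrite ltNge smallg.
- by rewrite -exprS.
Qed.

End MeanRank.

(** * Full rank of the Nisan-Wigderson polynomial *)

Lemma poly_eq_on (K : fieldType) (T : finType) (x : T -> K) (A : {set T})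
    (p r : {poly K}) :
  injective x -> (size p <= #|A|)%N -> (size r <= #|A|)%N ->
  {in A, forall j, p.[x j] = r.[x j]} -> p = r.
Proof.
move=> x_inj sp sr pr; apply/eqP; rewrite -subr_eq0; apply/negPn/negP => pr0.
have /(_ [seq x j | j <- enum A]) := max_poly_roots pr0.
rewrite size_map -cardE ltnNge.
rewrite (leq_trans (size_polyD _ _)) ?size_polyN ?geq_max ?sp //.
rewrite map_inj_uniq ?enum_uniq //; move=> /(_ _ isT) H; suff: false by []; apply: H.
apply/allP=> _ /mapP[j + ->]; rewrite mem_enum => jA.
by rewrite /root hornerD hornerN pr // subrr.
Qed.

Lemma mxrank_mxsub (F : fieldType) (m n m' n' : nat) (f : 'I_m' -> 'I_m)
    (g : 'I_n' -> 'I_n) (A : 'M[F]_(m, n)) :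
  (\rank (mxsub f g A) <= \rank A)%N.
Proof.
have sub_row k (B : 'M[F]_(m, k)) : (\rank (rowsub f B) <= \rank B)%N.
  by rewrite rowsubE mxrankM_maxr.
apply: (@leq_trans (\rank (colsub g A))).
  by rewrite -[mxsub f g A]/(mxsub (id \o f) g A) mxsub_comp.
by rewrite -mxrank_tr trmx_mxsub -[leqRHS]mxrank_tr rowsubE mxrankM_maxr.
Qed.

Section NisanWigderson.
Variables (F : fieldType) (K : finFieldType) (n d : nat).
Variables (phi : 'I_n -> K) (phi' : K -> 'I_n) (led : (d <= n)%N).
Hypotheses (phiK : cancel phi phi') (phi'K : cancel phi' phi).

Let x (j : 'I_d) : K := phi (widen_ord led j).

Lemma point_inj : injective x.
Proof. by move=> i j /(can_inj phiK) /(congr1 val) /= /val_inj. Qed.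

Lemma set_multilinear_NW : set_multilinear setT (NW F phi phi' led).
Proof.
move=> m /msupp_sum_le /flattenP[ms /mapP[f _] ->].
rewrite /xvar mprodXE msuppX inE => /eqP mE j; rewrite inE.
have {mE}-> : m = (\sum_(j < d) U_(mxvec_index (phi' (val f).[x j]) j))%MM := mE.
under eq_bigr do rewrite mnm_sumE.
rewrite exchange_big (bigD1 j) //= [X in (_ + X)%N]big1 => [|j' j'j].
  rewrite addn0 (bigD1 (phi' (val f).[x j])) //= mnm1E eqxx big1 // => i ij.
  by rewrite mnm1E mxvec_index_eq eq_sym (negPf ij).
by rewrite big1 // => i _; rewrite mnm1E mxvec_index_eq (negPf j'j) andbF.
Qed.

Lemma meval_NW (c : {ffun 'I_d -> 'I_n}) :
  (NW F phi phi' led).@[indicator_point F c] =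
    \sum_(f : {poly_d K} | ((size f).-1.*2 < d)%N)
      [forall j, phi' (val f).[x j] == c j]%:R.
Proof.
rewrite /NW rmorph_sum; apply: eq_bigr => f _; rewrite rmorph_prod /=.
under eq_bigr do rewrite mevalXU /indicator_point mxvecE mxE.
case: (boolP [forall j, _]) => [/forallP fc|].
  by rewrite big1 // => j _; rewrite fc.
rewrite negb_forall => /existsP[j fj].
by rewrite (bigD1 j) //= (negPf fj) mul0r.
Qed.

Variables (i0 : 'I_n) (J W : {set 'I_d}) (m : nat).
Hypotheses (m0 : (0 < m)%N) (cardJ : #|J| = m.*2) (cardJC : (#|~: J| <= 1)%N).
Hypotheses (cardJW : #|J :&: W| = m).

Let vanishing : {poly K} := \prod_(j in ~: J) ('X - (x j)%:P).
Let interp (g : {poly_m K}) : {poly K} := vanishing * val g + (phi i0)%:P.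
Let values (g : {poly_m K}) : {ffun 'I_d -> 'I_n} := [ffun j => phi' (interp g).[x j]].

Lemma size_interp g : (size (interp g) <= #|~: J| + m)%N.
Proof.
apply: leq_trans (size_polyD _ _) _; rewrite geq_max; apply/andP; split.
  apply: leq_trans (size_polyMleq _ _) _.
  rewrite /vanishing -big_enum size_prod_XsubC -cardE /= leq_add2l.
  exact: size_npoly.
by apply: leq_trans (size_polyC_leq1 _) _; rewrite addn_gt0 m0 orbT.
Qed.

Lemma interp_inj : injective interp.
Proof.
move=> g h /addIr /mulfI gh; apply: val_inj; apply: gh.
by apply/prodf_neq0 => j _; rewrite polyXsubC_eq0.
Qed.

Lemma interp_outside g j : j \notin J -> (interp g).[x j] = phi i0.
Proof.
move=> jJ; rewrite hornerD hornerM hornerC /vanishing (bigD1 j) ?inE //=.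
by rewrite hornerM hornerXsubC subrr !mul0r add0r.
Qed.

Lemma card_NW_points : d = (#|~: J| + m.*2)%N.
Proof. by rewrite -cardJ addnC cardsC card_ord. Qed.

(** Both polynomials have size at most [#|~: J| + m] and agree at that many distinct points. *)
Lemma interp_unique (A : {set 'I_d}) (f : {poly_d K}) g : #|J :&: A| = m ->
  ((size f).-1.*2 < d)%N ->
  (forall j, j \in ~: J :|: (J :&: A) -> phi' (val f).[x j] = values g j) ->
  val f = interp g.
Proof.
move=> cardA sf fg; have cardU : #|~: J :|: (J :&: A)| = (#|~: J| + m)%N.
  rewrite cardsU cardA -[RHS]subn0; congr (_ - _)%N; apply/eqP.
  by rewrite cards_eq0 setIA [~: J :&: J]setIC setICr set0I.
apply: (poly_eq_on point_inj (A := ~: J :|: (J :&: A))).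
- have {}sf : ((size (val f)).-1.*2 < d)%N := sf.
  rewrite cardU; move: card_NW_points m0 cardJC sf; move: #|~: J| (size (val f)) => e s.
  by lia.
- by rewrite cardU size_interp.
- by move=> j /fg; rewrite ffunE => /(can_inj phi'K).
Qed.

Lemma meval_NW_values g h :
  (NW F phi phi' led).@[indicator_point F (mix i0 J W (values g) (values h))] = (g == h)%:R.
Proof.
have cardJD : #|J :&: ~: W| = m by rewrite -setDE; have := cardsID W J; lia.
rewrite meval_NW.
have agree (f : {poly_d K}) : [forall j, phi' (val f).[x j] == mix i0 J W (values g) (values h) j] ->
    ((size f).-1.*2 < d)%N -> val f = interp g /\ val f = interp h.
  move=> /forallP fv sf; split; [apply: (interp_unique cardJW)|apply: (interp_unique cardJD)] => // j;
    rewrite !inE (eqP (fv j)) ffunE; case: (boolP (j \in J)) => [jJ /=|jJ _].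
  - by move=> ->.
  - by rewrite ffunE interp_outside // phiK.
  - by move=> /negPf ->.
  - by rewrite ffunE interp_outside // phiK.
have [gh|gh] := eqVneq g h; last first.
  rewrite big1 // => f sf; case: (boolP [forall j, _]) => // /agree /(_ sf) [fg fh].
  by rewrite (interp_inj (etrans (esym fg) fh)) eqxx in gh.
have sg : (size (interp g) <= d)%N.
  by move: (size_interp g) card_NW_points; move: #|~: J| (size (interp g)) => e s; lia.
rewrite (bigD1 (npolyp d (interp g))) /=; last first.
  rewrite npolypK //; move: (size_interp g) card_NW_points m0 cardJC.
  by move: #|~: J| (size (interp g)) => e s; lia.
rewrite npolypK // big1 ?addr0 => [|f /andP[sf fg]]; last first.
  case: (boolP [forall j, _]) => // /agree /(_ sf) [fE _].
  by case/eqP: fg; apply: val_inj; rewrite /= npolypK.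
rewrite -gh; case: (boolP [forall j, _]) => // /forallP[] j.
rewrite !ffunE; case: (boolP (j \in J)) => [_|jJ]; first by case: ifP.
by rewrite interp_outside // phiK.
Qed.

Lemma NW_split_rank_ge : #|K| = n ->
  (n ^ m <= \rank (split_mx i0 J W (NW F phi phi' led)))%N.
Proof.
move=> cardK.
pose s (k : 'I_#|{poly_m K}|) := enum_rank (values (enum_val k)).
apply: leq_trans (mxrank_mxsub s s _).
have -> : mxsub s s (split_mx i0 J W (NW F phi phi' led)) = 1%:M.
  apply/matrixP=> k l; rewrite !mxE !enum_rankK meval_NW_values.
  by rewrite (inj_eq enum_val_inj).
by rewrite mxrank1 card_npoly cardK.
Qed.

End NisanWigderson.

(** * The size bound and its asymptotics *)

Lemma inv_sqrt_nat (R : realType) (n : nat) : (16 <= n)%N ->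
  exists v : R, [/\ 0 <= v, v <= 4^-1 & n%:R * v ^+ 2 = 1].
Proof.
move=> n16; have n0 : 0 < n%:R :> R by rewrite ltr0n (leq_trans _ n16).
exists (Num.sqrt n%:R)^-1; split.
- by rewrite invr_ge0 sqrtr_ge0.
- rewrite lef_pV2 ?posrE ?sqrtr_gt0 //.
  rewrite -(@ler_pXn2r _ 2) ?nnegrE ?sqrtr_ge0 // sqr_sqrtr ?(ltW n0) //.
  have : 16 <= n%:R :> R by rewrite ler_nat.
  by rewrite expr2; lra.
- by rewrite exprVn sqr_sqrtr ?ltW // mulfV // gt_eqF.
Qed.

Section FormulaBound.
Variables (R : realType) (F : fieldType) (K : finFieldType) (n d Delta : nat).
Variables (phi : 'I_n -> K) (phi' : K -> 'I_n) (led : (d <= n)%N).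

Lemma formula_size_decay (q : R) (t : formula F n d) :
  cancel phi phi' -> cancel phi' phi -> #|K| = n -> (16 <= n)%N -> (1 < d)%N ->
  set_multilinear_formula t -> product_depth t = Delta -> (0 < Delta)%N ->
  feval t = NW F phi phi' led ->
  1 < q -> q ^+ Delta = (d./2.*2)%:R ->
  1 <= (d%:R + 1) * ((fsize t)%:R * rank_decay q).
Proof.
move=> phiK phi'K cardK n16 d2 smt dt Delta0 tNW q1 qDelta.
have [v [v0 v4 nv]] := inv_sqrt_nat R n16.
have n_gt0 : (0 < n)%N by apply: leq_trans n16.
have d_gt0 : (0 < d)%N by apply: ltnW.
pose i0 : 'I_n := Ordinal n_gt0; pose j0 : 'I_d := Ordinal d_gt0.
pose J : {set 'I_d} := if odd d then [set~ j0] else setT; pose m := d./2.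
have m0 : (0 < m)%N by rewrite /m; lia.
have dE : d = (odd d + m.*2)%N by rewrite odd_double_half.
have [cardJ cardJC] : #|J| = m.*2 /\ (#|~: J| <= 1)%N.
  rewrite /J; case: ifP dE => _ dE; last by rewrite setCT cards0 cardsT card_ord.
  by rewrite setCK cards1 cardsC1 card_ord dE.
have qJ : q ^+ Delta <= #|J|%:R by rewrite cardJ qDelta.
have qn : q <= n%:R.
  have : q <= q ^+ Delta by rewrite -[leLHS]expr1 ler_weXn2l // ltW.
  move=> /le_trans; apply; rewrite qDelta ler_nat; apply: leq_trans led.
  by rewrite [leqRHS]dE leq_addl.
pose f := feval t.
have rankW W : imbalance J W == 0%N -> (n ^ m <= \rank (split_mx i0 J W f))%N.
  rewrite imbalance_eq0 cardJ doubleK => /andP[/eqP JW _].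
  by rewrite /f tNW; apply: NW_split_rank_ge => //; rewrite setIC.
(* Nonvanishing is what identifies [support_set f] with all blocks. *)
have f0 : f != 0.
  have [W JW] : exists W, imbalance J W == 0%N.
    have : (0 < #|[set W : {set 'I_d} | #|W :&: J| == m]|)%N.
      by rewrite card_subsets_meeting muln_gt0 expn_gt0 bin_gt0 cardJ -addnn leq_addl.
    move=> /card_gt0P[W]; rewrite inE => JW; exists W.
    by rewrite imbalance_eq0 cardJ doubleK JW odd_double.
  apply: contraTneq (rankW W JW) => ->; rewrite -ltnNge (_ : split_mx _ _ _ 0 = 0).
    by rewrite mxrank0 expn_gt0 n_gt0.
  by apply/matrixP=> x y; rewrite !mxE rmorph0.
have suppf : support_set f = setT.
  by apply: support_setE f0; rewrite /f tNW; apply: set_multilinear_NW.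
have le_mean : subset_mean (nrank i0 J v f) <= (fsize t)%:R * rank_decay q.
  apply: (@formula_mean_nrank _ _ _ _ _ _ _ _ v0 v4 nv led (ltW q1) qn t Delta) => //.
    by rewrite dt.
  by rewrite -/f suppf setTI.
have ge_mean : central_prob R m <= subset_mean (nrank i0 J v f).
  have Jeven : ~~ odd #|J| by rewrite cardJ odd_double.
  have <- : #|J|./2 = m by rewrite cardJ doubleK.
  rewrite -(balanced_prob R Jeven); apply: subset_mean_le => W.
  have [JW|] := eqVneq (imbalance J W) 0%N; last by rewrite nrank_ge0.
  rewrite /nrank suppf setTI cardJ -mul2n exprM.
  apply: (@le_trans _ _ ((n ^ m)%:R * (v ^+ 2) ^+ m)).
    by rewrite natrX -exprMn nv expr1n.
  by rewrite ler_wpM2r ?exprn_ge0 // ler_nat rankW // JW.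
(* A balanced [W] has probability at least 1 / (2m + 1), and 2m is at most d. *)
apply: le_trans (central_prob_ge R m) _; rewrite mulrC.
apply: ler_pM; rewrite ?central_prob_ge0 ?addr_ge0 ?mulr_ge0 //.
  by rewrite lerD2r -natrM ler_nat mul2n [leqRHS]dE leq_addl.
exact: le_trans ge_mean le_mean.
Qed.

End FormulaBound.

(** With u = ln d / Delta, so that [d ^ (1 / Delta)] is [expR u], rounding d down to an even number
    costs at most a factor 2 in [q], and [rank_decay q] is at most [expR (- (expR u * u / 16))].
    Half of this exponent pays for the claimed bound, the other half for d + 1. *)
Lemma root_decay (R : realType) (d Delta : nat) :
  expR (expR 64) <= d%:R :> R -> (0 < Delta)%N ->
  Delta%:R <= log2 d%:R / log2 (log2 d%:R) :> R ->
  exists q : R, [/\ 1 < q, q ^+ Delta = (d./2.*2)%:R &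
    d%:R `^ (32^-1 * d%:R `^ (Delta%:R^-1) / Delta%:R) * (d%:R + 1) * rank_decay q <= 1].
Proof.
move=> d_big Delta0 Delta_le; set l : R := ln d%:R.
have D0 : 0 < Delta%:R :> R by rewrite ltr0n.
have D1 : 1 <= Delta%:R :> R by rewrite ler1n.
have d_gt0 : 0 < d%:R :> R by apply: lt_le_trans d_big; apply: expR_gt0.
have l_big : expR 64 <= l by rewrite -ler_expR lnK ?posrE.
have l65 : 65 <= l by apply: le_trans l_big; apply: le_trans (expR_ge1Dx _); lra.
have ln2_gt0 : 0 < ln 2 :> R by rewrite ln_gt0 // ltr1n.
have ln2_le1 : ln 2 <= 1 :> R.
  by rewrite -ler_expR lnK ?posrE // (le_trans _ (expR_ge1Dx _)).
have lL : l <= log2 d%:R by rewrite ler_pdivlMr // -/l ler_piMr //; lra.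
have L0 : 0 < log2 d%:R :> R by apply: lt_le_trans lL; lra.
have lnl : 64 <= ln l by rewrite -ler_expR lnK // posrE; lra.
have lnL : ln l <= ln (log2 d%:R : R) by rewrite ler_ln ?posrE; lra.
set u : R := l / Delta%:R.
(* The change of base cancels in the bound on Delta, which reads Delta <= ln d / ln (log2 d). *)
have uL : ln (log2 d%:R) <= u.
  rewrite ler_pdivlMr // mulrC -ler_pdivlMr; last lra.
  apply: le_trans Delta_le _; rewrite /log2 -/l.
  rewrite invf_div mulrA mulfVK //; lra.
have u64 : 64 <= u by lra.
have TE : d%:R `^ (Delta%:R^-1) = expR u.
  by rewrite /powR gt_eqF // mulrC.
have lT : l <= expR u.
  by apply: le_trans lL _; rewrite -[leLHS]lnK ?ler_expR ?posrE.
have d8 : (8 <= d)%N.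
  rewrite -(ler_nat R); apply: le_trans d_big.
  by apply: le_trans (expR_ge1Dx _); have := expR_ge1Dx (64 : R); lra.
pose D : R := (d./2.*2)%:R.
have D_gt0 : 1 < D by rewrite ltr1n; move: d8; clear; lia.
have dD : d%:R <= 2 * D by rewrite -natrM ler_nat; move: d8; clear; lia.
have lnD : l - ln 2 <= ln D.
  have : ln d%:R <= ln (2 * D) by rewrite ler_ln ?posrE //; lra.
  by rewrite lnM ?posrE //; [rewrite -/l; lra|lra].
exists (expR (ln D / Delta%:R)); set q := expR _.
have lnq : u - ln 2 <= ln q.
  rewrite expRK /u ler_pdivlMr // mulrBl mulfVK ?gt_eqF //.
  have : ln 2 * 1 <= ln 2 * Delta%:R :> R by rewrite ler_wpM2l // ltW.
  by lra.
split.
- by rewrite expR_gt1 divr_gt0 // ln_gt0.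
- rewrite -expRM_natl mulrCA mulfV ?gt_eqF // mulr1 lnK // posrE; lra.
have qT : expR u / 2 <= q.
  by rewrite -[2](@lnK R) ?posrE // -expRN -expRD -[leRHS]lnK ?posrE ?expR_gt0 // ler_expR.
have q0 : 0 < q by apply: expR_gt0.
have lnq1 : ln q <= ln (1 + q) by rewrite ler_ln ?posrE; lra.
have decay_exp : expR u * u / 16 <= q * ln (1 + q) / 4.
  have : (expR u / 2) * (u / 2) <= q * ln (1 + q).
    by apply: ler_pM; rewrite ?divr_ge0 ?expR_ge0 //; lra.
  by lra.
have d1 : d%:R + 1 <= expR (2 * l).
  rewrite expRM_natl lnK ?posrE // natr1 -natrX ler_nat expnS expn1; move: d8; clear; nia.
rewrite {1}/powR gt_eqF // TE -/l.
have -> : 32^-1 * expR u / Delta%:R * l = expR u * u / 32.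
  by rewrite /u; field; rewrite gt_eqF.
apply: (@le_trans _ _ (expR (expR u * u / 32) * expR (2 * l) * expR (- (expR u * u / 16)))).
  apply: ler_pM; rewrite ?mulr_ge0 ?expR_ge0 ?addr_ge0 //.
    by rewrite ler_wpM2l ?expR_ge0.
  by rewrite /rank_decay ler_expR lerN2.
rewrite -!expRD -[leRHS]expR0 ler_expR.
(* The remaining exponent is [2 * l - expR u * u / 32]; since [l <= expR u], [u >= 64] suffices,
   whence the threshold on d. *)
have : expR u * 64 <= expR u * u by rewrite ler_wpM2l ?expR_ge0.
by lra.
Qed.

Theorem theorem3p2 (R : realType) :
  exists c : R, 0 < c /\ exists d0 : nat,
  forall (k n : nat) (K : finFieldType) (phi : 'I_n -> K) (phi' : K -> 'I_n)
         (F : fieldType) (d Delta : nat) (led : (d <= n)%N)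
         (t : formula F n d),
    (1 <= k)%N -> n = (2 ^ k)%N -> #|K| = n ->
    cancel phi phi' -> cancel phi' phi ->
    (d0 < d)%N -> (1 <= Delta)%N ->
    Delta%:R <= log2 d%:R / log2 (log2 d%:R) :> R ->
    set_multilinear_formula t -> product_depth t = Delta ->
    feval t = NW F phi phi' led ->
    d%:R `^ (c * d%:R `^ (Delta%:R^-1) / Delta%:R) <= (fsize t)%:R :> R.
Proof.
exists 32^-1; split; first by rewrite invr_gt0.
exists (Num.bound (expR (expR 64) : R)).
move=> k n K phi phi' F d Delta led t _ _ cardK phiK phi'K d0d Delta0 Delta_le.
move=> smt dt tNW.
have d_big : expR (expR 64) <= d%:R :> R.
  apply: ltW; apply: lt_le_trans (archi_boundP (expR_ge0 _)) _.
  by rewrite ler_nat ltnW.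
have d16 : (16 <= d)%N.
  rewrite -(ler_nat R); apply: le_trans d_big.
  by apply: le_trans (expR_ge1Dx _); have := expR_ge1Dx (64 : R); lra.
have [q [q1 qDelta decay]] := root_decay d_big Delta0 Delta_le.
have size_ge := formula_size_decay phiK phi'K cardK (leq_trans d16 led)
  (leq_trans (isT : (1 < 16)%N) d16) smt dt Delta0 tNW q1 qDelta.
set X := _ `^ _ in decay *.
have X0 : 0 <= X by apply: powR_ge0.
have := ler_wpM2l X0 size_ge; rewrite mulr1 => /le_trans; apply.
have := ler_wpM2r (ler0n R (fsize t)) decay; rewrite mul1r; apply: le_trans.
by rewrite le_eqVlt; apply/orP; left; apply/eqP; ring.
Qed.
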